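(* Let $X\subset\mathbb{P}^n$ be a closed subscheme of dimension zero (over $\mathbb{C}$), supported at distinct closed points $p_1,\dots,p_t$. For each $1\leq i\leq t$, let $\mu_i:=\mu_{\mathscr{O}_{X,p_i}}$ be the Loewy length of the local ring $\mathscr{O}_{X,p_i}$. Then $$H^1(\mathbb{P}^n,\mathscr{I}_X(k))=0\quad\text{for all integers } k\geq \mu_1+\mu_2+\cdots+\mu_t+t-1,$$ i.e., $X$ is $(\mu_1+\mu_2+\cdots+\mu_t+t)$-regular.
   Context: The ground field is $\mathbb{C}$. For a local Artinian ring $(A,\mathfrak{m})$, the Loewy length is $\mu_A:=\max\{i\mid \mathfrak{m}^i\neq 0\}$, a nonnegative integer (with $\mathfrak{m}^0=A$); if $\mathfrak{m}=0$, i.e. $A$ is a field, then $\mu_A=0$. For a closed subscheme $X\subset\mathbb{P}^n$, $\mathscr{I}_X$ denotes its ideal sheaf; $X$ is $m$-regular if $H^i(\mathbb{P}^n,\mathscr{I}_X(m-i))=0$ for all $i>0$. *)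

(* Defs.v *)
From HB Require Import structures.
From mathcomp Require Import all_boot all_order all_algebra.
From mathcomp Require Import fraction ring_quotient complex.
From mathcomp Require Import boolp reals.
From mathcomp Require Import mpoly.

Set Implicit Arguments.
Unset Strict Implicit.
Unset Printing Implicit Defensive.

Import GRing.Theory.
Local Open Scope ring_scope.
Local Notation "x %:F" := (@FracField.tofrac _ x) : ring_scope.

(* P^n is Proj F[X_0, ..., X_n]. *)
Notation coord_ring F n := {mpoly F[n.+1]}.
Notation frac_field F n := {fraction {mpoly F[n.+1]}}.

Record homog_ideal (F : fieldType) (n : nat) := HomogIdeal {
  ideal_pred :> coord_ring F n -> Prop;
  ideal0 : ideal_pred 0;
  idealD : forall f g, ideal_pred f -> ideal_pred g -> ideal_pred (f + g);
  idealM : forall f g, ideal_pred g -> ideal_pred (f * g);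
  ideal_homog : forall d f, ideal_pred f -> ideal_pred (pihomog mdeg d f)
}.

Definition ideal_sub (F : fieldType) (n : nat) (I J : homog_ideal F n) :=
  forall f, I f -> J f.

(* The homogeneous ideal X stands for the closed subscheme Proj (S / X) of P^n,
   where S = F[X_0, ..., X_n].  Every closed subscheme of P^n is of this form;
   the ideal is not required to be saturated. *)
Definition closed_subscheme := homog_ideal.

(* The points of Proj (S / X): the homogeneous primes of S that contain X but
   not all the variables. *)
Record point (F : fieldType) (n : nat) (X : closed_subscheme F n) := Point {
  point_ideal : homog_ideal F n;
  point_proper : ~ point_ideal 1;
  point_prime :
    forall f g, point_ideal (f * g) -> point_ideal f \/ point_ideal g;
  point_relevant : exists i : 'I_n.+1, ~ point_ideal 'X_i;
  point_sub : ideal_sub X point_ideal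
}.
Coercion point_ideal : point >-> homog_ideal.

Fact frac_subE (K : fieldType) (a b c d : K) : b != 0 -> d != 0 ->
  a / b - c / d = (a * d - b * c) / (b * d).
Proof. by move=> b0 d0; rewrite -mulNr addf_div // mulNr [c * b]mulrC. Qed.

Fact frac_lincombE (K : fieldType) (a b c d e f : K) :
  b != 0 -> d != 0 -> f != 0 ->
  a / b * (c / d) + e / f = (a * f * c + b * d * e) / (b * d * f).
Proof.
move=> b0 d0 f0; rewrite mulf_div addf_div ?mulf_neq0 //.
by rewrite [a * f * c]mulrAC [e * _]mulrC.
Qed.

Section Subscheme.
Variables (F : fieldType) (n : nat).
Local Notation S := (coord_ring F n).
Local Notation K := (frac_field F n).

Definition closed_point (X : closed_subscheme F n) (p : point X) :=
  forall q : point X, ideal_sub p q -> q = p.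

Definition has_chain (X : closed_subscheme F n) (d : nat) :=
  exists c : 'I_d.+1 -> point X, forall i j : 'I_d.+1,
    (i < j)%N -> ideal_sub (c i) (c j) /\ ~ ideal_sub (c j) (c i).

(* Krull dimension; the irreducible closed subsets of X are the closures of its
   points, so chains of the former are chains of the latter. *)
Definition dimension (X : closed_subscheme F n) (d : nat) :=
  has_chain X d /\ ~ has_chain X d.+1.

Section Stalk.
Variables (X : closed_subscheme F n) (p : point X).

(* The local ring of P^n at p: the degree 0 part of the localization of S at p,
   as a subring of the field of fractions of S. *)
Definition ambient_local_ring : {pred K} := fun x =>
  `[< exists d (f g : S), [/\ f \is d.-homog, g \is d.-homog, ~ p g
                            & x = f%:F / g%:F] >].

Lemma point_frac_neq0 (g : S) : ~ p g -> g%:F != 0 :> K.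
Proof.
by move=> pg; rewrite tofrac_eq0; apply/eqP => g0; apply: pg; rewrite g0; apply: ideal0.
Qed.

Lemma point_notM (f g : S) : ~ p f -> ~ p g -> ~ p (f * g).
Proof. by move=> pf pg /point_prime[]. Qed.

Fact ambient_local_ring_closed : subring_closed ambient_local_ring.
Proof.
split.
- apply/asboolP; exists 0%N, 1, 1; split; rewrite ?dhomog1 //.
    exact: point_proper.
  by rewrite rmorph1 divr1.
- move=> _ _ /asboolP[d [f [g [hf hg pg ->]]]] /asboolP[e [f' [g' [hf' hg' pg' ->]]]].
  apply/asboolP; exists (d + e)%N, (f * g' - g * f'), (g * g').
  have g0 := point_frac_neq0 pg; have g'0 := point_frac_neq0 pg'.
  split; [|exact: dhomogM|exact: point_notM|].
    by apply: rpredB; apply: dhomogM.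
  by rewrite rmorphB !rmorphM; apply: frac_subE g0 g'0.
- move=> _ _ /asboolP[d [f [g [hf hg pg ->]]]] /asboolP[e [f' [g' [hf' hg' pg' ->]]]].
  apply/asboolP; exists (d + e)%N, (f * f'), (g * g').
  split; [exact: dhomogM|exact: dhomogM|exact: point_notM|].
  by rewrite !tofracM; apply: mulf_div.
Qed.

HB.instance Definition _ :=
  GRing.isSubringClosed.Build K ambient_local_ring ambient_local_ring_closed.

Record ambient_stalk := AmbientStalk {
  stalk_val : K;
  stalk_valP : stalk_val \in ambient_local_ring
}.

HB.instance Definition _ := [isSub for stalk_val].
HB.instance Definition _ := [Choice of ambient_stalk by <:].
HB.instance Definition _ :=
  [SubChoice_isSubComNzRing of ambient_stalk by <:].

(* The stalk at p of the ideal sheaf of X. *)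
Definition stalk_ideal : {pred ambient_stalk} := fun x =>
  `[< exists d (f g : S), [/\ f \is d.-homog, g \is d.-homog, X f, ~ p g
                            & val x = f%:F / g%:F] >].

Fact stalk_ideal_closed : idealr_closed stalk_ideal.
Proof.
split.
- apply/asboolP; exists 0%N, 0, 1; split; rewrite ?dhomog1 ?rpred0 //.
  + exact: ideal0.
  + exact: point_proper.
  by rewrite rmorph0 mul0r.
- apply/negP => /asboolP[d [f [g [_ _ Xf pg]]]] /= e.
  have g0 := point_frac_neq0 pg.
  have /eqP : g%:F = f%:F :> K by rewrite -[LHS]mul1r e divfK.
  by rewrite tofrac_eq => /eqP gf; apply: pg; rewrite gf; apply: point_sub.
- move=> [_ /[dup] /asboolP[d [a [b [ha hb pb ->]]]] xP] u v.
  move=> /asboolP[e [f [g [hf hg Xf pg eu]]]] /asboolP[e' [f' [g' [hf' hg' Xf' pg' ev]]]].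
  have b0 := point_frac_neq0 pb.
  have g0 := point_frac_neq0 pg; have g'0 := point_frac_neq0 pg'.
  apply/asboolP; exists (d + e + e')%N, ((a * g') * f + (b * g) * f'), (b * g * g').
  split.
  + apply: rpredD.
      by rewrite mulrAC; do 2?apply: dhomogM.
    by do 2?apply: dhomogM.
  + by do 2?apply: dhomogM.
  + by apply: idealD; apply: idealM.
  + by do 2?apply: point_notM.
  by rewrite rmorphD rmorphM /= eu ev rmorphD !rmorphM; apply: frac_lincombE b0 g0 g'0.
Qed.

HB.instance Definition _ :=
  isIdealr.Build ambient_stalk stalk_ideal stalk_ideal_closed.

(* The local ring O_{X,p}. *)
Definition local_ring : comNzRingType := {ideal_quot stalk_ideal}.

End Stalk.

(* The sections over D_+(\prod_(j in J) X_j) of the k-th twist of the ideal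
   sheaf of X: the degree k part of the localization of the graded ideal X at
   \prod_(j in J) X_j. *)
Definition ideal_sheaf (X : closed_subscheme F n) (k : int)
    (J : {set 'I_n.+1}) (x : K) :=
  exists (N d : nat) (f : S),
    [/\ f \is d.-homog, X f, d%:Z = k + (N * #|J|)%N%:Z
      & x = f%:F / ((\prod_(j in J) 'X_j) ^+ N)%:F].

(* The cohomology of a quasi-coherent sheaf E on P^n is that of its (alternating)
   Cech complex for the cover by the affine opens U_j = D_+(X_j).  A p-cochain
   assigns to each J = {j_0 < ... < j_p} a section E J over
   U_{j_0} \cap ... \cap U_{j_p} = D_+(X_{j_0} ... X_{j_p}).  The sheaves
   considered here are subsheaves of the constant sheaf K, so that restriction
   maps are inclusions. *)
Definition cech_cochain (E : {set 'I_n.+1} -> K -> Prop) (p : nat)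
    (c : {set 'I_n.+1} -> K) :=
  forall J : {set 'I_n.+1}, #|J| = p.+1 -> E J (c J).

Definition cech_diff (c : {set 'I_n.+1} -> K) (J : {set 'I_n.+1}) : K :=
  \sum_(l in J) (-1) ^+ #|[set j in J | (j < l)%N]| * c (J :\ l).

Definition cech_cocycle (E : {set 'I_n.+1} -> K -> Prop) (p : nat)
    (c : {set 'I_n.+1} -> K) :=
  cech_cochain E p c /\
  forall J : {set 'I_n.+1}, #|J| = p.+2 -> cech_diff c J = 0.

Definition cech_coboundary (E : {set 'I_n.+1} -> K -> Prop) (p : nat)
    (c : {set 'I_n.+1} -> K) :=
  match p with
  | 0 => forall J : {set 'I_n.+1}, #|J| = 1%N -> c J = 0
  | q.+1 => exists2 b, cech_cochain E q b &
      forall J : {set 'I_n.+1}, #|J| = p.+1 -> c J = cech_diff b J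
  end.

Definition cohomology_vanishes (E : {set 'I_n.+1} -> K -> Prop) (p : nat) :=
  forall c, cech_cocycle E p c -> cech_coboundary E p c.

Definition regular (X : closed_subscheme F n) (m : int) :=
  forall i : nat, (0 < i)%N -> cohomology_vanishes (ideal_sheaf X (m - i%:Z)) i.

End Subscheme.

Section Loewy.
Variable A : comNzRingType.

(* The maximal ideal, when A is local. *)
Definition nonunit (a : A) := ~ exists b, a * b = 1.

(* The i-th power of the ideal I; it is the whole of A for i = 0. *)
Definition ideal_exp (I : A -> Prop) (i : nat) (x : A) :=
  exists r (a : 'I_r -> A) (y : 'I_r -> 'I_i -> A),
    (forall j l, I (y j l)) /\ x = \sum_j a j * \prod_l y j l.

Definition maximal_power_neq0 (i : nat) :=
  exists2 x, ideal_exp nonunit i x & x <> 0.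

(* mu = max { i | m^i != 0 } for a local ring A with maximal ideal m. *)
Definition loewy_length (mu : nat) :=
  maximal_power_neq0 mu /\ forall i, maximal_power_neq0 i -> (i <= mu)%N.

End Loewy.

(* Main.v *)
Require Import Defs.
From HB Require Import structures.
From mathcomp Require Import all_boot all_order all_algebra.
From mathcomp Require Import complex reals.
From mathcomp Require Import fraction generic_quotient ring_quotient.
From mathcomp Require Import boolp mpoly.
From mathcomp Require classical_sets.
From mathcomp Require Import zify.
Import Order.TTheory GRing.Theory Num.Theory.
Local Open Scope ring_scope.

(** The local statement is that [mu_i + 1] linear forms vanishing at [p_i] have
    a product which lies in the ideal of [X] near [p_i], because the
    [mu_i + 1]-st power of the maximal ideal of the local ring is zero
    ([loewy_saturation]).  So a germ of section of [O_X] at [p_i] only depends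
    on a Taylor expansion of order [mu_i], and it is represented by a form of
    any degree at least [mu_i] ([local_interpolation]).  Multiplying by
    [mu_l + 1] linear forms through each other point [p_l] but not through
    [p_i] makes this form vanish on [X] near the [p_l] ([separating_form]).
    Summing over [i], the forms of degree [D] realize all families of germs on
    [X] as soon as [D] is at least the sum of the [mu_i + 1], minus [1]
    ([interpolation]).

    For the cohomology, let [c] be a Cech cocycle of degree [q + 1] with values
    in the ideal sheaf twisted by [k >= - n].  As [H^(q + 1)(O(k)) = 0]
    ([structure_sheaf_vanishing]), [c = d b] for a cochain [b] with values in
    [O(k)], which is a cocycle modulo the ideal sheaf.  At a given point [p_i]
    some variable [X_j] is invertible, and the cone with vertex [j] contracts
    the Cech complex of germs ([cech_cone_homotopy]): it gives, at [p_i], a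
    primitive of [b] modulo the ideal sheaf.  These primitives at the various
    points are germs of a single cochain [b'] by interpolation, in degree
    [D = k + N * q] if denominators of order [N] are used.  For [q > 0] this
    exceeds any bound, while for [q = 0] it is [k], whence the bound on [k] for
    [H^1].  Now [b - d b'] has all its germs in the ideal sheaf, so it is a
    section of it ([ideal_sheaf_of_germs]), and [c = d (b - d b')].

    Two facts relate the homogeneous primes of [S] to geometry: there are enough
    of them to detect powers of a form ([prime_avoiding], by Zorn's lemma), and
    the closed ones have coordinates in the ground field
    ([closed_point_coords]). *)

Set Implicit Arguments.
Unset Strict Implicit.
Unset Printing Implicit Defensive.

(** * The cone homotopy of the Cech complex *)

Section Cech.
Variables (m : nat) (V : pzRingType).
Implicit Types (c b : {set 'I_m} -> V) (J : {set 'I_m}) (j l : 'I_m).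

Definition cech_sign l J : V := (-1) ^+ #|[set j in J | (j < l)%N]|.

Definition cech_delta c J : V := \sum_(l in J) cech_sign l J * c (J :\ l).

(** The contracting homotopy of the Cech complex of a cover one of whose members,
the [j]-th, is the whole space: a section over the intersection of [j |: J] is
then a section over that of [J]. *)
Definition cech_cone j c J : V :=
  if j \in J then 0 else cech_sign j J * c (j |: J).

Lemma cech_sign_sqr l J : cech_sign l J * cech_sign l J = 1.
Proof. by rewrite /cech_sign -expr2 sqrr_sign. Qed.

Lemma cech_signD1 j l J : l \in J ->
  cech_sign j J = (-1) ^+ (l < j)%N * cech_sign j (J :\ l).
Proof.
move=> lJ; rewrite /cech_sign -exprD; congr (_ ^+ _).
rewrite (cardsD1 l) inE lJ /=; congr (_ + _)%N.
by apply: eq_card => i; rewrite !inE andbA.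
Qed.

Lemma cech_signU1 j l J : l \notin J ->
  cech_sign j (l |: J) = (-1) ^+ (l < j)%N * cech_sign j J.
Proof. by move=> lJ; rewrite (@cech_signD1 j l) ?setU11 // setU1K. Qed.

Lemma cech_sign_swap j l J : j \notin J -> l \in J ->
  cech_sign l J * cech_sign j (J :\ l) = - (cech_sign j J * cech_sign l (j |: J)).
Proof.
move=> jJ lJ; rewrite (cech_signD1 j lJ) cech_signU1 // /cech_sign -!exprD.
rewrite -[RHS]mulN1r -exprS -[LHS]signr_odd -[RHS]signr_odd; congr (_ ^+ _).
have jl : j != l by apply: contraNneq jJ => ->.
rewrite /= !oddD !oddb.
by case: ltngtP jl => [||/val_inj ->]; rewrite ?eqxx //= => _ _;
  case: (odd _); case: (odd _).
Qed.

Lemma cech_cone_homotopy j c J :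
  cech_delta (cech_cone j c) J + cech_cone j (cech_delta c) J = c J.
Proof.
rewrite [X in _ + X]/cech_cone; case: ifPn => jJ.
  rewrite addr0 /cech_delta (bigD1 j) //= big1 ?addr0; last first.
    by move=> l /andP[lJ lj]; rewrite /cech_cone !inE eq_sym lj jJ mulr0.
  rewrite /cech_cone !inE eqxx /= setD1K // mulrA (cech_signD1 j jJ) ltnn mul1r.
  by rewrite cech_sign_sqr mul1r.
rewrite {2}/cech_delta (big_setU1 _ jJ) /= setU1K // mulrDr mulrA.
have -> : cech_sign j (j |: J) = cech_sign j J by rewrite cech_signU1 // ltnn mul1r.
rewrite cech_sign_sqr mul1r addrCA [X in _ + X](_ : _ = 0) ?addr0 //.
rewrite mulr_sumr -big_split big1 //= => l lJ.
have lj : j != l by apply: contraNneq jJ => ->.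
rewrite /cech_cone !inE (negPf jJ) andbF !mulrA cech_sign_swap // mulNr.
suff -> : (j |: J) :\ l = j |: J :\ l by rewrite addNr.
by apply/setP => i; rewrite !inE; case: eqVneq => // -> /=; rewrite eq_sym (negPf lj).
Qed.

Lemma cech_deltaB c b J :
  cech_delta (fun J => c J - b J) J = cech_delta c J - cech_delta b J.
Proof. by rewrite /cech_delta -sumrB; apply: eq_bigr => l _; rewrite mulrBr. Qed.

Lemma eq_cech_delta c b J :
  (forall l, l \in J -> c (J :\ l) = b (J :\ l)) -> cech_delta c J = cech_delta b J.
Proof. by move=> e; apply: eq_bigr => l lJ; rewrite e. Qed.

(** The homotopy reduces the vanishing at [J] to that at the smaller set [J :\ j]:
[d h + h d = id] makes [h] commute with [d d], and for [j] in [J] the value of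
[d d c] at [J] is up to sign that of [h (d d c)] at [J :\ j]. *)
Lemma cech_delta_delta c J : cech_delta (cech_delta c) J = 0.
Proof.
elim: {J}#|J| {-2}J (erefl #|J|) c => [|d IH] J.
  by move=> /cards0_eq -> c; rewrite /cech_delta big_set0.
move=> eJ c; have [j jJ] : exists j, j \in J by apply/card_gt0P; rewrite eJ.
have jnot : j \notin J :\ j by rewrite !inE eqxx.
have h : cech_cone j (cech_delta (cech_delta c)) (J :\ j) = 0.
  have := cech_cone_homotopy j (cech_delta c) (J :\ j).
  rewrite (@eq_cech_delta _ (fun K => c K - cech_delta (cech_cone j c) K)).
    rewrite cech_deltaB IH ?subr0; last first.
      by move: eJ; rewrite (cardsD1 j) jJ => -[].
    by rewrite -[RHS]addr0 => /addrI.
  by move=> l _; apply/eqP; rewrite eq_sym subr_eq addrC cech_cone_homotopy.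
move: h; rewrite /cech_cone (negPf jnot) setD1K //.
move/(congr1 ( *%R (cech_sign j (J :\ j)))).
by rewrite mulrA cech_sign_sqr mul1r mulr0.
Qed.
End Cech.

(** * Homogeneous ideals and primes *)

Section HomogeneousIdeals.
Variables (F : fieldType) (n : nat).
Local Notation S := {mpoly F[n.+1]}.
Implicit Types (I P : homog_ideal F n) (f g : S).

Lemma pihomogMr d e r f : f \is e.-homog ->
  pihomog mdeg d (r * f) = if (e <= d)%N then pihomog mdeg (d - e) r * f else 0.
Proof.
move=> hf; pose k := (msize r + d.+1)%N.
have piE i : pihomog mdeg d (pihomog mdeg i r * f) =
    if d == (i + e)%N then pihomog mdeg i r * f else 0.
  have hi := dhomogM (pihomogP mdeg i r) hf.
  case: eqP => [->|/eqP]; first by rewrite pihomog_dE.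
  by rewrite eq_sym => /pihomog_ne0 ->.
rewrite {1}(@pihomog_partitionE _ _ mdeg k r) ?leq_addr // mulr_suml raddf_sum /=.
under eq_bigr do rewrite piE.
rewrite -big_mkcond /=; case: leqP => ed; last first.
  by rewrite big_pred0 // => i; apply/negbTE; rewrite neq_ltn (leq_trans ed) ?leq_addl.
have kd : (d - e < k)%N by rewrite /k addnS ltnS (leq_trans (leq_subr _ _)) ?leq_addl.
rewrite (big_pred1 (Ordinal kd)) // => i /=.
by rewrite -val_eqE /=; apply/eqP/eqP; lia.
Qed.

Lemma idealB I f g : I f -> I g -> I (f - g).
Proof. by move=> If Ig; rewrite -mulN1r; apply/idealD/idealM. Qed.

Lemma idealDl I f g : I g -> I (f + g) -> I f.
Proof. by move=> Ig Ifg; rewrite -[f](addrK g); apply: idealB. Qed.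

Lemma idealMl I f g : I f -> I (f * g).
Proof. by rewrite mulrC; apply: idealM. Qed.

Lemma idealZ I c f : I f -> I (c *: f).
Proof. by rewrite -mul_mpolyC; apply: idealM. Qed.

Lemma ideal_sum I (T : Type) (r : seq T) (Q : pred T) (f : T -> S) :
  (forall i, Q i -> I (f i)) -> I (\sum_(i <- r | Q i) f i).
Proof. by apply: big_ind => [|? ?]; [apply: ideal0|apply: idealD]. Qed.

Lemma ideal_pihomog I f : (forall d, I (pihomog mdeg d f)) -> I f.
Proof.
by move=> h; rewrite (@pihomog_partitionE _ _ mdeg _ f (leqnn _)); apply: ideal_sum.
Qed.

Section Sum1.
Variables (I : homog_ideal F n) (d : nat) (a : S) (ha : a \is d.-homog).
Definition ideal_add1_pred f := exists2 g, I g & exists r, f = g + r * a.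

Fact ideal_add1_0 : ideal_add1_pred 0.
Proof. by exists 0; [apply: ideal0|exists 0; rewrite mul0r addr0]. Qed.

Fact ideal_add1_D f g :
  ideal_add1_pred f -> ideal_add1_pred g -> ideal_add1_pred (f + g).
Proof.
move=> [f1 If1 [r ->]] [g1 Ig1 [s ->]].
by exists (f1 + g1); [apply: idealD|exists (r + s); rewrite mulrDl addrACA].
Qed.

Fact ideal_add1_M f g : ideal_add1_pred g -> ideal_add1_pred (f * g).
Proof.
move=> [g1 Ig1 [s ->]].
by exists (f * g1); [apply: idealM|exists (f * s); rewrite mulrDr mulrA].
Qed.

Fact ideal_add1_homog e f : ideal_add1_pred f -> ideal_add1_pred (pihomog mdeg e f).
Proof.
move=> [g Ig [r ->]]; rewrite raddfD /= (pihomogMr _ _ ha).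
exists (pihomog mdeg e g); first exact: ideal_homog.
by case: ifP => _; [eexists|exists 0; rewrite mul0r].
Qed.

Definition ideal_add1 :=
  HomogIdeal ideal_add1_0 ideal_add1_D ideal_add1_M ideal_add1_homog.

Lemma ideal_add1_sub : ideal_sub I ideal_add1.
Proof. by move=> f If; exists f => //; exists 0; rewrite mul0r addr0. Qed.

Lemma ideal_add1_mem : ideal_add1 a.
Proof. by exists 0; [apply: ideal0|exists 1; rewrite mul1r add0r]. Qed.
End Sum1.

Section Colon.
Variables (I : homog_ideal F n) (d : nat) (a : S) (ha : a \is d.-homog).
Definition ideal_colon_pred f := I (f * a).

Fact ideal_colon_0 : ideal_colon_pred 0.
Proof. by rewrite /ideal_colon_pred mul0r; apply: ideal0. Qed.

Fact ideal_colon_D f g :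
  ideal_colon_pred f -> ideal_colon_pred g -> ideal_colon_pred (f + g).
Proof. by rewrite /ideal_colon_pred mulrDl; apply: idealD. Qed.

Fact ideal_colon_M f g : ideal_colon_pred g -> ideal_colon_pred (f * g).
Proof. by rewrite /ideal_colon_pred -mulrA; apply: idealM. Qed.

Fact ideal_colon_homog e f :
  ideal_colon_pred f -> ideal_colon_pred (pihomog mdeg e f).
Proof.
move=> /(@ideal_homog _ _ I (e + d)).
by rewrite (pihomogMr _ _ ha) leq_addl addnK.
Qed.

Definition ideal_colon :=
  HomogIdeal ideal_colon_0 ideal_colon_D ideal_colon_M ideal_colon_homog.
End Colon.

(** If a product lies in a homogeneous ideal, so does the product of the leading
forms; one of these can then be subtracted, which lowers the size. *)
Lemma homog_prime P :
  (forall d e f g, f \is d.-homog -> g \is e.-homog -> P (f * g) -> P f \/ P g) ->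
  forall f g, P (f * g) -> P f \/ P g.
Proof.
move=> hP.
suff H k : forall f g, (msize f + msize g <= k)%N -> P (f * g) -> P f \/ P g.
  by move=> f g; apply: H.
elim: k => [|k IH] f g.
  rewrite leqn0 addn_eq0 msize_poly_eq0 => /andP[/eqP-> _] _.
  by left; apply: ideal0.
have [->|f0] := eqVneq f 0; first by left; apply: ideal0.
have [->|g0] := eqVneq g 0; first by right; apply: ideal0.
pose top (f : S) := pihomog mdeg (msize f).-1 f.
have szP (h : S) : h != 0 -> msize h = (msize h).-1.+1.
  by move=> h0; rewrite prednK // lt0n msize_poly_eq0.
have topE h : h != 0 -> h = (\sum_(d < (msize h).-1) pihomog mdeg d h) + top h.
  move=> h0; have hk : (msize h <= (msize h).-1.+1)%N by rewrite -szP.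
  by rewrite {1}(pihomog_partitionE hk) big_ord_recr.
have lowsz h : h != 0 -> (msize (h - top h) < msize h)%N.
  move=> h0; rewrite {1}(topE _ h0) addrK (szP _ h0) ltnS.
  apply: leq_trans (msize_sum _ _ _) _; apply/bigmax_leqP => d _.
  have := pihomogP mdeg d h; set u := pihomog _ _ _ => hu.
  rewrite msizeE big_seq; apply/bigmax_leqP_seq => m ms _.
  by rewrite (dhomog_mf hu ms).
have topM : pihomog mdeg ((msize f).-1 + (msize g).-1) (f * g) = top f * top g.
  rewrite [X in X * g](topE _ f0) mulrDl raddfD /= [top f * g]mulrC.
  rewrite (pihomogMr _ _ (pihomogP _ _ f)) leq_addr addKn [_ * top f]mulrC.
  rewrite mulr_suml raddf_sum /= big1 ?add0r // => d _; rewrite mulrC.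
  rewrite (pihomogMr _ _ (pihomogP _ _ f)); case: ifP => // _.
  rewrite pihomogE big_seq_cond big_pred0 ?mul0r // => m.
  apply/negbTE/negP => /andP[/msize_mdeg_lt + /eqP E]; rewrite E.
  by move: (ltn_ord d); rewrite (szP _ g0); lia.
move=> sz Pfg.
have /hP : P (top f * top g) by rewrite -topM; apply: ideal_homog.
move=> /(_ _ _ (pihomogP _ _ _) (pihomogP _ _ _)) [Pt|Pt].
  have Pl : P ((f - top f) * g) by rewrite mulrBl; apply: idealB => //; apply: idealMl.
  have [|Pf|Pg] := IH _ _ _ Pl; last by right.
    by rewrite -ltnS (leq_trans _ sz) // ltn_add2r lowsz.
  by left; rewrite -(subrK (top f) f); apply: idealD.
have Pl : P (f * (g - top g)) by rewrite mulrBr; apply: idealB => //; apply: idealM.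
have [|Pf|Pg] := IH _ _ _ Pl; last 2 first.
- by left.
- by right; rewrite -(subrK (top g) g); apply: idealD.
by rewrite -ltnS (leq_trans _ sz) // ltn_add2l lowsz.
Qed.

(** An ideal maximal among the homogeneous ideals above [I] containing no power
of [f] is prime: adjoining to it a form outside it makes a power of [f]
appear, and two such powers multiply to a power of [f]. *)
Lemma prime_avoiding I d f : f \is d.-homog -> (forall N, ~ I (f ^+ N)) ->
  exists P, [/\ ideal_sub I P, ~ P f, ~ P 1 &
    forall g h : S, P (g * h) -> P g \/ P h].
Proof.
move=> hf If.
pose T := {P : homog_ideal F n | ideal_sub I P /\ forall N, ~ P (f ^+ N)}.
pose R (P Q : T) := `[< ideal_sub (sval P) (sval Q) >].
have t0 : T by exists I; split=> // g.
have [||A Atot|[M [IM Mf]] /= Mmax] := @classical_sets.ZL_preorder T t0 R.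
- by move=> P; apply/asboolP => g.
- by move=> P Q P' /asboolP h /asboolP h'; apply/asboolP => g /h /h'.
- have [[P0 AP0]|A0] := pselect (exists t, A t); last first.
    by exists t0 => P AP; case: A0; exists P.
  pose U g := exists2 t, A t & sval t g.
  have U0 : U 0 by exists P0 => //; apply: ideal0.
  have UD g h : U g -> U h -> U (g + h).
    move=> [P AP Pg] [Q AQ Qh].
    have [/asboolP s|/asboolP s] := Atot _ _ AP AQ.
      by exists Q => //; apply: idealD => //; apply: s.
    by exists P => //; apply: idealD => //; apply: s.
  have UM g h : U h -> U (g * h) by case=> P AP Ph; exists P => //; apply: idealM.
  have Uh e g : U g -> U (pihomog mdeg e g).
    by case=> P AP Pg; exists P => //; apply: ideal_homog.
  have UT : ideal_sub I (HomogIdeal U0 UD UM Uh) /\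
      forall N, ~ HomogIdeal U0 UD UM Uh (f ^+ N).
    split=> [g Ig|N [P AP]]; last exact: (svalP P).2.
    by exists P0 => //; apply: (svalP P0).1.
  exists (exist _ _ UT : T) => P AP; apply/asboolP => g Pg.
  by exists P.
exists M; split=> //; first by move=> Mf1; apply: (Mf 1%N).
  exact: (Mf 0%N).
(* Maximality: adjoining to [M] a form outside [M] captures a power of [f]. *)
have grow e g : g \is e.-homog -> ~ M g -> exists N, ideal_add1_pred M g (f ^+ N).
  move=> hg Mg; apply: contrapT => noN.
  have MT : ideal_sub I (ideal_add1 M hg) /\ forall N, ~ ideal_add1 M hg (f ^+ N).
    by split=> [h /IM Mh|N hN]; [apply: ideal_add1_sub|apply: noN; exists N].
  have /asboolP /= s : R (exist _ _ MT) (exist _ M (conj IM Mf)).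
    by apply: Mmax; apply/asboolP; apply: ideal_add1_sub.
  by apply/Mg/s/ideal_add1_mem.
apply: homog_prime => d1 d2 g h hg hh Mgh.
apply: contrapT => /not_orP[Mg Mh].
have [N [u Mu [r eN]]] := grow _ _ hg Mg.
have [N' [u' Mu' [r' eN']]] := grow _ _ hh Mh.
apply: (Mf (N + N')%N); rewrite exprD eN eN'.
rewrite mulrDl; apply: idealD; first exact: idealMl.
rewrite mulrDr; apply: idealD; first exact: idealM.
by rewrite mulrACA; apply: idealM.
Qed.
End HomogeneousIdeals.

(** * Coordinates of closed points *)

Section HomogeneousInduction.
Variables (F : fieldType) (n : nat).
Local Notation S := {mpoly F[n.+1]}.

Lemma dhomog_ind (Q : nat -> S -> Prop) :
    (forall d, Q d 0) -> (forall d f g, Q d f -> Q d g -> Q d (f + g)) ->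
    (forall c, Q 0%N c%:MP) -> (forall d f i, Q d f -> Q d.+1 ('X_i * f)) ->
  forall d f, f \is d.-homog -> Q d f.
Proof.
move=> Q0 QD Qc QX d f /dhomogP hf; rewrite [f]mpolyE big_seq.
apply: big_ind => [||m /hf]; [exact: Q0|exact: QD|].
elim: d m {hf} (f@_m) => [|d IH] m c.
  by move/eqP; rewrite mdeg_eq0 => /eqP ->; rewrite mpolyX0 alg_mpolyC.
move=> md; have [i mi] : exists i, m i != 0%N.
  apply/existsP; apply: contra_eqT md => /existsPn m0.
  by rewrite /= mdegE big1 // => i _; apply/eqP; move: (m0 i); rewrite negbK.
have mE : m = (U_(i) + (m - U_(i)))%MM.
  by apply/mnmP => l; rewrite mnmDE mnmBE mnm1E; case: eqVneq => [<-|] /=; lia.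
rewrite mE mpolyXD scalerAr; apply: QX; apply: IH.
by move: md; rewrite /= [in LHS]mE mdegD mdeg1 => -[].
Qed.

Definition shifted_var (j : 'I_n.+1) (a : 'I_n.+1 -> F) (l : 'I_n.+1) : S :=
  'X_l - a l *: 'X_j.

Lemma dhomog_var (l : 'I_n.+1) : ('X_l : S) \is 1.-homog.
Proof. by rewrite dhomogX /= mdeg1. Qed.

Lemma dhomog_varX (l : 'I_n.+1) d : ('X_l ^+ d : S) \is d.-homog.
Proof. by have := dhomogMn d (dhomog_var l); rewrite mul1n. Qed.

Lemma dhomog_shifted_var j a l : shifted_var j a l \is 1.-homog.
Proof. by rewrite rpredB ?rpredZ ?dhomog_var. Qed.

(** The forms of degree [d - 1], where only [0] has degree [- 1]. *)
Definition dhomog_pred d (f : S) : bool :=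
  if d is d'.+1 then f \is d'.-homog else f == 0.

(** When [a j = 1], this is the Taylor expansion to order one of a form at the
point with coordinates [a], and [c] is the value of the form there. *)
Lemma dhomog_expand (j : 'I_n.+1) (a : 'I_n.+1 -> F) d u : u \is d.-homog ->
  exists c v, u = c *: 'X_j ^+ d + \sum_l shifted_var j a l * v l /\
    forall l, dhomog_pred d (v l).
Proof.
move: d u; apply: dhomog_ind.
- move=> d; exists 0, (fun=> 0); rewrite scale0r add0r big1 => [|l _]; last by rewrite mulr0.
  by split=> // l; case: d => /= [|d]; rewrite ?eqxx ?rpred0.
- move=> d f g [c [v [-> hv]]] [c' [v' [-> hv']]].
  exists (c + c'), (fun l => v l + v' l); split.
    rewrite scalerDl addrACA -big_split /=; congr (_ + _).
    by apply: eq_bigr => l _; rewrite mulrDr.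
  move=> l; case: d {hv}(hv l) {hv'}(hv' l) => /= [|d]; last exact: rpredD.
  by move=> /eqP-> /eqP->; rewrite addr0.
- move=> c; exists c, (fun=> 0); rewrite big1 => [|l _]; last by rewrite mulr0.
  by rewrite addr0 expr0 alg_mpolyC; split=> // l; rewrite /= eqxx.
- move=> d f i [c [v [-> hv]]].
  exists (c * a i), (fun l => 'X_i * v l + (if l == i then c *: 'X_j ^+ d else 0)).
  split.
    under [in RHS]eq_bigr do rewrite mulrDr.
    rewrite big_split /= [X in _ = _ + (_ + X)](bigD1 i) //= eqxx.
    rewrite [X in _ + (_ + (_ + X))]big1 ?addr0; last first.
      by move=> l /negPf->; rewrite mulr0.
    rewrite mulrDr mulr_sumr [LHS]addrC [RHS]addrCA; congr (_ + _).
      by apply: eq_bigr => l _; rewrite mulrCA.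
    rewrite /shifted_var mulrBl -!scalerAr -scalerAl -exprS scalerA addrC.
    by rewrite subrK.
  move=> l /=; apply: rpredD.
    case: d {hv}(hv l) => /= [/eqP->|d hv]; first by rewrite mulr0 rpred0.
    exact: dhomogM (dhomog_var i) hv.
  case: eqP => _; last exact: rpred0.
  exact/rpredZ/dhomog_varX.
Qed.

Lemma ideal_dhomog_expand (P : homog_ideal F n) j a d u : ~ P 'X_j ->
    (forall f g, P (f * g) -> P f \/ P g) -> ~ P 1 ->
    (forall l, P (shifted_var j a l)) -> u \is d.-homog -> P u ->
  exists2 v, u = \sum_l shifted_var j a l * v l & forall l, dhomog_pred d (v l).
Proof.
move=> Pj prP P1 Pa hu; have [c [v [-> hv]]] := dhomog_expand j a hu.
have Pv : P (\sum_l shifted_var j a l * v l).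
  by apply: ideal_sum => l _; apply: idealMl.
move=> /(idealDl Pv) H; exists v => //.
suff -> : c = 0 by rewrite scale0r add0r.
apply/eqP/negPn/negP => c0.
have : P ('X_j ^+ d).
  rewrite -[_ ^+ _]scale1r -(mulVf c0) -scalerA; exact: idealZ.
elim: d {u hu hv H} => [|d IH]; first by rewrite expr0.
by rewrite exprS => /prP[].
Qed.

Lemma prime_exp (P : homog_ideal F n) (f : S) N : ~ P 1 ->
  (forall f g, P (f * g) -> P f \/ P g) -> P (f ^+ N) -> P f.
Proof.
by move=> P1 prP; elim: N => [|N IH]; rewrite ?expr0 // exprS => /prP[].
Qed.
End HomogeneousInduction.

Section RationalPoints.
Variables (F : closedFieldType) (n : nat).
Local Notation S := {mpoly F[n.+1]}.

(** The homogenization of [q] in degree [d], evaluated at [(x, y)]. *)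
Definition binary_form (x y : S) d (q : {poly F}) : S :=
  \sum_(a < d.+1) q`_a *: (x ^+ a * y ^+ (d - a)).

Lemma binary_form_linear_factor x y d (q : {poly F}) z : (size q <= d.+1)%N ->
  binary_form x y d.+1 (('X - z%:P) * q) = (x - z *: y) * binary_form x y d q.
Proof.
move=> sq; rewrite /binary_form mulrBl.
under eq_bigr do rewrite coefB scalerBl.
rewrite sumrB mulrBl; congr (_ - _).
  rewrite big_ord_recl coefXM scale0r add0r mulr_sumr; apply: eq_bigr => a _.
  by rewrite coefXM /= -scalerAr exprS mulrA subSS.
rewrite big_ord_recr /= coefCM [X in z * X]nth_default // mulr0 scale0r addr0.
rewrite mulr_sumr; apply: eq_bigr => a _; rewrite coefCM.
rewrite subSn -1?ltnS // exprS mulrCA -scalerA -scalerAr -scalerAl.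
by rewrite !scalerA mulrC.
Qed.

(** Over an algebraically closed field a binary form is a product of linear
forms, and a prime ideal containing the product contains a factor. *)
Lemma prime_binary_form (P : homog_ideal F n) x y d (q : {poly F}) :
    ~ P 1 -> (forall f g, P (f * g) -> P f \/ P g) -> ~ P y ->
    q != 0 -> (size q <= d.+1)%N -> P (binary_form x y d q) ->
  exists z, P (x - z *: y).
Proof.
move=> P1 prP Py q0.
have [rs ->] := closed_field_poly_normal q.
have c0 : lead_coef q != 0 by rewrite lead_coef_eq0.
move: (lead_coef q) c0 => c c0.
rewrite size_scale // size_prod_XsubC ltnS.
elim: rs d => [|z rs IH] d /=.
  move=> _; rewrite big_nil /binary_form big_ord_recl big1 => [|a _]; last first.
    by rewrite coefZ coef1 mulr0 scale0r.
  rewrite coefZ coef1 mulr1 mul1r subn0 addr0 => H; exfalso; apply: Py.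
  apply: (@prime_exp _ _ _ _ d P1 prP).
  by rewrite -[_ ^+ _]scale1r -(mulVf c0) -scalerA; apply/idealZ.
case: d => // d; rewrite ltnS => sd; rewrite big_cons scalerAr.
rewrite binary_form_linear_factor ?size_scale ?size_prod_XsubC //.
by move=> /prP[Pz|/IH]; [exists z|apply].
Qed.

Section ClosedPoint.
Variables (X : closed_subscheme F n) (p : point X).
Hypothesis clp : closed_point p.
Variable j : 'I_n.+1.
Hypothesis pj : ~ p 'X_j.

(** Otherwise a homogeneous prime above [p] would contain ['X_j] and avoid ['X_l],
and would be a point strictly larger than the closed point [p]. *)
Lemma closed_point_var_power l : exists N, ideal_add1_pred p 'X_j ('X_l ^+ N).
Proof.
apply: contrapT => /forallNP noN.
have [Q [sQ Ql Q1 prQ]] := @prime_avoiding _ _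
  (ideal_add1 p (dhomog_var F j)) _ _ (dhomog_var F l) noN.
have pQ : ideal_sub p Q by move=> f pf; apply/sQ/ideal_add1_sub.
pose Q2 := Point Q1 prQ (ex_intro _ l Ql) (fun f Xf => pQ f (@point_sub _ _ _ p f Xf)).
have /(congr1 (@point_ideal _ _ _)) /= E := clp (q := Q2) pQ.
apply: pj; rewrite -E; apply/sQ/ideal_add1_mem.
Qed.

(** Modulo [p] and ['X_j] every variable is nilpotent, hence every form of large
degree vanishes.  So the graded pieces of [S / p] have bounded dimension, all of
them being images of a fixed one under powers of ['X_j]. *)
Lemma closed_point_bounded : exists D, forall d f, f \is (D + d).-homog ->
  exists2 s, s \is D.-homog & p (f - s * 'X_j ^+ d).
Proof.
have [N hN] := choice closed_point_var_power.
exists (\sum_l N l)%N; elim=> [|d IH] f hf.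
  exists f; first by rewrite -[(\sum_l N l)%N]addn0.
  by rewrite expr0 mulr1 subrr; apply: ideal0.
have [g hg Pg] : exists2 g, g \is (\sum_l N l + d).-homog & p (f - g * 'X_j).
  have [g pg [r E]] : ideal_add1 p (dhomog_var F j) f.
    rewrite [f]mpolyE big_seq; apply: ideal_sum => m /(dhomog_mf hf) /= md.
    apply: (@idealZ _ _ (ideal_add1 p (dhomog_var F j))).
    (* A monomial of degree greater than the sum of the [N l] has some exponent
       at least [N l]. *)
    have [l Nl] : exists l, (N l <= m l)%N.
      apply/existsP; apply: contra_eqT md => /existsPn h.
      rewrite mdegE addnS ltn_eqF //= ltnS.
      rewrite (leq_trans _ (leq_addr _ _)) // leq_sum // => l _.
      by apply: ltnW; rewrite ltnNge h.
    have -> : m = (U_(l) *+ N l + (m - U_(l) *+ N l))%MM.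
      apply/mnmP => i; rewrite mnmDE mnmBE mulmnE mnm1E.
      by case: eqVneq => [<-|] /=; lia.
    rewrite mpolyXD -mpolyXn.
    exact: (@idealMl _ _ (ideal_add1 p (dhomog_var F j)) _ _ (hN l)).
  exists (pihomog mdeg (\sum_l N l + d) r); first exact: pihomogP.
  rewrite -(pihomog_dE hf) E raddfD /= (pihomogMr _ _ (dhomog_var F j)).
  by rewrite addnS ltnS leq0n subSS subn0 addrK; apply: ideal_homog.
have [s hs ps] := IH _ hg; exists s => //.
rewrite exprSr mulrA -[f](subrK (g * 'X_j)) -addrA -mulrBl.
by apply: idealD => //; apply: idealMl.
Qed.

(** The monomials in ['X_i] and ['X_j] of a large degree [d] are [d + 1] elements of
a graded piece of [S / p] of bounded dimension; a linear relation between them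
is a binary form in [p], which then has a linear factor in [p]. *)
Lemma closed_point_ratio i : exists z, p ('X_i - z *: 'X_j).
Proof.
have [D hD] := closed_point_bounded.
pose V := dhomog n.+1 F D; pose h := \dim {:V}.
pose f (a : 'I_(D + h).+1) : S := 'X_i ^+ a * 'X_j ^+ (D + h - a).
have hf a : f a \is (D + h).-homog.
  have <- : (a + (D + h - a))%N = (D + h)%N by rewrite subnKC // -ltnS.
  by apply: dhomogM; apply: dhomog_varX.
have /choice[s hs] : forall a, exists s : V, p (f a - val s * 'X_j ^+ h).
  by move=> a; have [s hs ps] := hD _ _ (hf a); exists (DHomog hs).
pose t := [tuple s a | a < (D + h).+1].
(* [t] has [D + h + 1] entries in a space of dimension [h]. *)
have tnf : ~~ free t.
  apply/negP => /eqP fr; have : (\dim <<t>> <= h)%N by apply: dimvS; apply: subvf.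
  by rewrite fr size_tuple; lia.
have [k k0 [a ka]] : exists2 k : 'I_(D + h).+1 -> F,
    \sum_a k a *: s a = 0 & exists a, k a != 0.
  apply: contrapT => H; move/negP: tnf; apply; apply/freeP => k k0 a.
  apply/eqP/negPn/negP => ka; apply: H; exists k; last by exists a.
  by rewrite -[RHS]k0; apply: eq_bigr => b _;
    rewrite (nth_map b) ?size_enum_ord // nth_ord_enum.
pose q : {poly F} := \poly_(b < (D + h).+1) k (inord b).
have qE (b : 'I_(D + h).+1) : q`_b = k b by rewrite coef_poly ltn_ord inord_val.
apply: (@prime_binary_form p _ _ (D + h) q (@point_proper _ _ _ p) (@point_prime _ _ _ p)).
- exact: pj.
- by apply: contra_neq ka => q0; rewrite -qE q0 coef0.
- exact: size_poly.
have -> : binary_form 'X_i 'X_j (D + h) q = \sum_b k b *: (f b - val (s b) * 'X_j ^+ h).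
  rewrite /binary_form; under eq_bigr do rewrite qE.
  under [RHS]eq_bigr do rewrite scalerBr [_ *: (val _ * _)]scalerAl.
  rewrite sumrB -mulr_suml.
  suff -> : \sum_b k b *: val (s b) = 0 by rewrite mul0r subr0.
  by rewrite -[RHS](congr1 val k0) raddf_sum.
by apply: ideal_sum => b _; apply: idealZ.
Qed.
End ClosedPoint.

(** The Nullstellensatz for closed points: they have coordinates in the ground
field. *)
Lemma closed_point_coords (X : closed_subscheme F n) (p : point X) :
  closed_point p ->
  exists j a, ~ p 'X_j /\ forall l, p (shifted_var j a l).
Proof.
move=> clp; have [j pj] := point_relevant p.
by have [a pa] := choice (closed_point_ratio clp pj); exists j, a.
Qed.
End RationalPoints.

(** * Germs along the subscheme *)

Section Germs.
Variables (F : fieldType) (n : nat) (X : closed_subscheme F n) (p : point X).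
Local Notation S := {mpoly F[n.+1]}.
Local Notation K := {fraction {mpoly F[n.+1]}}.
Local Notation "f %:F" := (@FracField.tofrac _ f).

(** The elements of [S] whose image in the localization of [S] at [p] lies in the
ideal generated by [X]. *)
Definition saturation (f : S) := exists2 u, ~ p u & X (u * f).

Lemma saturation0 : saturation 0.
Proof. by exists 1; [apply: point_proper|rewrite mulr0; apply: ideal0]. Qed.

Lemma saturationD f g : saturation f -> saturation g -> saturation (f + g).
Proof.
move=> [u pu Xu] [v pv Xv]; exists (u * v); first exact: point_notM.
rewrite mulrDr; apply: idealD; last by rewrite -mulrA; apply: idealM.
by rewrite mulrAC; apply: idealMl.
Qed.

Lemma saturationM f g : saturation g -> saturation (f * g).
Proof. by move=> [u pu Xu]; exists u => //; rewrite mulrCA; apply: idealM. Qed.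

(** All that is needed of the quotient defining [local_ring]: it is onto, and its
kernel is contained in [stalk_ideal]. *)
Lemma local_ring_proj :
  exists pi : {rmorphism ambient_stalk p -> local_ring p},
    (forall b, exists s, pi s = b) /\ (forall s, pi s = 0 -> s \in @stalk_ideal _ _ _ p).
Proof.
exists (\pi_({ideal_quot (@stalk_ideal _ _ _ p)})%qT
  : {rmorphism ambient_stalk p -> {ideal_quot (@stalk_ideal _ _ _ p)}}).
split=> [b|s s0]; first by exists (repr b); exact: reprK.
rewrite -[s]subr0 Quotient.idealrBE; apply/eqP.
by rewrite [LHS]s0 [RHS]rmorph0.
Qed.

Lemma stalk_idealP (s : ambient_stalk p) : s \in @stalk_ideal _ _ _ p ->
  exists f g, [/\ X f, ~ p g & val s = f%:F / g%:F].
Proof. by move=> /asboolP[d [f [g [_ _ Xf pg e]]]]; exists f, g. Qed.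

Lemma frac_eq (a b c d : S) : ~ p b -> ~ p d ->
  a%:F / b%:F = c%:F / d%:F :> K -> a * d = c * b.
Proof.
move=> pb pd /eqP; rewrite eqr_div ?(point_frac_neq0 (p := p)) //.
by rewrite -!tofracM tofrac_eq => /eqP.
Qed.

(** Dividing by a variable outside [p] turns linear forms vanishing at [p] into
elements of the maximal ideal of the local ring, a product of [mu + 1] of which
is zero. *)
Lemma loewy_saturation mu (zs : seq S) : loewy_length (local_ring p) mu ->
  size zs = mu.+1 -> (forall z, z \in zs -> z \is 1.-homog /\ p z) ->
  saturation (\prod_(z <- zs) z).
Proof.
move=> [_ mumax] sz hz; have [j pj] := point_relevant p.
have {}hz (i : 'I_mu.+1) : zs`_i \is 1.-homog /\ p zs`_i.
  by apply/hz/mem_nth; rewrite sz.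
have /choice[s hs] : forall i : 'I_mu.+1, exists s : ambient_stalk p,
    val s = (zs`_i)%:F / ('X_j)%:F.
  move=> i; have [h1 hp] := hz i.
  suff sP : (zs`_i)%:F / ('X_j)%:F \in ambient_local_ring p by exists (AmbientStalk sP).
  by apply/asboolP; exists 1%N, zs`_i, 'X_j; split=> //; apply: dhomog_var.
have [pi [pi_surj pi0]] := local_ring_proj.
have y0 : \prod_i pi (s i) = 0.
  apply: contrapT => yn0; suff : (mu.+1 <= mu)%N by rewrite ltnn.
  apply: mumax; exists (\prod_i pi (s i)) => //.
  exists 1%N, (fun=> 1), (fun=> fun i => pi (s i)); split; last by rewrite big_ord1 mul1r.
  (* [z / 'X_j] is not a unit of the local ring: an inverse would, after
     clearing denominators, put an element outside [p] into [p]. *)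
  move=> _ i [b eb]; have [h1 hp] := hz i; have [r er] := pi_surj b.
  have /pi0/stalk_idealP[f [g [Xf pg]]] : pi (s i * r - 1) = 0.
    by rewrite rmorphB rmorphM rmorph1 /= er eb subrr.
  rewrite rmorphB rmorphM rmorph1 /= hs.
  have /asboolP[d [a [c [_ _ pc ->]]]] := stalk_valP r.
  have -> : 1 = 1%:F / 1%:F :> K by rewrite rmorph1 divr1.
  rewrite mulf_div -!tofracM frac_subE ?(point_frac_neq0 (p := p)) //;
    try exact: point_proper.
    rewrite -!tofracM -tofracB => /frac_eq; rewrite !mulr1 => E.
    have pjc := point_notM pj pc; apply: (point_notM pjc pg).
    have -> : 'X_j * c * g = zs`_i * (a * g) - f * ('X_j * c).
      by rewrite -E // mulrBl mulrA subKr.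
    apply: idealB; first exact: idealMl.
    by apply/idealMl/(@point_sub _ _ _ p).
  exact: point_notM.
move: y0; rewrite -rmorph_prod => /pi0/stalk_idealP[f [g [Xf pg]]].
rewrite rmorph_prod /=; under eq_bigr do rewrite hs.
have -> : \prod_(i < mu.+1) ((zs`_i)%:F / ('X_j)%:F) =
    (\prod_(z <- zs) z)%:F / ('X_j ^+ mu.+1)%:F :> K.
  rewrite prodf_div prodr_const card_ord -tofracXn rmorph_prod; congr (_ / _).
  by rewrite [RHS](big_nth 0) big_mkord sz.
have pjm : ~ p ('X_j ^+ mu.+1).
  by move/(prime_exp (@point_proper _ _ _ p) (@point_prime _ _ _ p)).
by move/frac_eq => /(_ pjm pg) E; exists g => //; rewrite mulrC E; apply: idealMl.
Qed.
End Germs.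

(** * Interpolation by forms of given degree *)

Section LocalInterpolation.
Variables (F : fieldType) (n : nat) (X : closed_subscheme F n) (p : point X).
Local Notation S := {mpoly F[n.+1]}.
Variables (j : 'I_n.+1) (a : 'I_n.+1 -> F) (mu : nat).
Hypotheses (pj : ~ p 'X_j) (pa : forall l, p (shifted_var j a l)).
Hypothesis loewy_mu : loewy_length (local_ring p) mu.

Lemma dhomog_prod_seq (ws : seq S) : (forall w, w \in ws -> w \is 1.-homog) ->
  \prod_(w <- ws) w \is (size ws).-homog.
Proof.
elim: ws => [|w ws IH] h; first by rewrite big_nil dhomog1.
rewrite big_cons -[size _]/(1 + size ws)%N.
by apply: dhomogM; [apply/h/mem_head|apply: IH => v vs; apply: h; rewrite inE vs orbT].
Qed.

(** Descending induction on the order of vanishing [size ws] at [p].  Past order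
[mu] the product of [ws] is zero in the local ring.  Below, [u] and [g] have
the same leading term up to the scalar [c / ga] and a power of ['X_j], so that
subtracting a multiple of [g] leaves terms with one more linear factor
vanishing at [p]. *)
Lemma local_interpolation_step e0 g e : g \is e0.-homog -> ~ p g -> (mu <= e)%N ->
  forall r (ws : seq S), (size ws + r)%N = mu.+1 ->
    (forall w, w \in ws -> w \is 1.-homog /\ p w) ->
  forall d u, u \is d.-homog -> (d + size ws)%N = (e0 + e)%N ->
  exists2 f, f \is e.-homog & saturation p (\prod_(w <- ws) w * u - g * f).
Proof.
move=> hg pg mue; elim=> [|r IH] ws sz hws d u hu du.
  exists 0; rewrite ?rpred0 // mulr0 subr0 mulrC; apply: saturationM.
  by apply: loewy_saturation loewy_mu _ hws; rewrite -sz addn0.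
have [c [v [eu hv]]] := dhomog_expand j a hu.
have [ga [y [eg hy]]] := dhomog_expand j a hg.
have ga0 : ga != 0.
  apply: contra_not_neq pg => ga0; rewrite eg ga0 scale0r add0r.
  by apply: ideal_sum => l _; apply: idealMl.
have sze : (size ws <= e)%N by rewrite (leq_trans _ mue) // -ltnS -sz addnS ltnS leq_addr.
pose W := \prod_(w <- ws) w; pose f0 := (c / ga) *: 'X_j ^+ (e - size ws).
have hf0 : f0 \is (e - size ws).-homog by rewrite rpredZ ?dhomog_varX.
have hW : W \is (size ws).-homog by apply: dhomog_prod_seq => w /hws[].
have hd : d = (e0 + (e - size ws))%N by lia.
have hug : u - g * f0 \is d.-homog.
  by rewrite rpredB //; rewrite hd; apply: dhomogM.
have pug : p (u - g * f0).
  rewrite eu eg hd exprD mulrDl opprD addrACA; apply: idealD.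
    rewrite /f0 -scalerAl -scalerAr scalerA [ga * _]mulrC divfK // subrr.
    exact: ideal0.
  apply: idealB; first by apply: ideal_sum => l _; apply: idealMl.
  by apply: idealMl; apply: ideal_sum => l _; apply: idealMl.
have [z ez hz] := ideal_dhomog_expand pj (@point_prime _ _ _ p)
  (@point_proper _ _ _ p) pa hug pug.
have step l : exists2 f, f \is e.-homog &
    saturation p (W * (shifted_var j a l * z l) - g * f).
  have [->|zl0] := eqVneq (z l) 0.
    exists 0; first exact: rpred0.
    by rewrite !mulr0 subr0; apply: saturation0.
  have := hz l; case ed: d => [|d'] /=; first by rewrite (negPf zl0).
  move=> hzl; have [|w|/=||f hf sf] := IH (shifted_var j a l :: ws) _ _ d' (z l).
  - by rewrite -addSnnS in sz.
  - by rewrite inE => /orP[/eqP->|/hws//]; split; [apply: dhomog_shifted_var|].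
  - exact: hzl.
  - by rewrite -du ed addSnnS.
  - by exists f => //; move: sf; rewrite big_cons [_ * W]mulrC mulrA.
have /choice[f hf] : forall l, exists f, f \is e.-homog /\
    saturation p (W * (shifted_var j a l * z l) - g * f).
  by move=> l; have [f ? ?] := step l; exists f.
exists (W * f0 + \sum_l f l).
  apply: rpredD; last by apply: rpred_sum => l _; have [] := hf l.
  by rewrite -(subnKC sze); apply: dhomogM.
have -> : W * u - g * (W * f0 + \sum_l f l) =
    \sum_l (W * (shifted_var j a l * z l) - g * f l).
  rewrite sumrB -!mulr_sumr -ez mulrBr mulrDr opprD addrA.
  by rewrite [g * (W * _)]mulrCA.
apply: big_ind => [|f1 f2|l _]; [exact: saturation0|exact: saturationD|].
by have [] := hf l.
Qed.

(** The forms of any degree [e >= mu] represent all of the local ring at [p]: the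
fraction [f / g] agrees there with some form [h] of degree [e]. *)
Lemma local_interpolation e0 g e f : g \is e0.-homog -> ~ p g -> (mu <= e)%N ->
  f \is (e0 + e).-homog ->
  exists2 h, h \is e.-homog & saturation p (f - g * h).
Proof.
move=> hg pg mue hf.
have [] := @local_interpolation_step e0 g e hg pg mue mu.+1 [::] _ _ (e0 + e) f hf _ => //.
  by rewrite /= addn0.
by move=> h hh; rewrite big_nil mul1r; exists h.
Qed.
End LocalInterpolation.

Section Interpolation.
Variables (F : closedFieldType) (n t : nat) (X : closed_subscheme F n).
Local Notation S := {mpoly F[n.+1]}.
Local Notation K := {fraction {mpoly F[n.+1]}}.
Local Notation "f %:F" := (@FracField.tofrac _ f).
Variables (p : 'I_t -> point X) (mu : 'I_t -> nat).
Hypotheses (injp : injective p) (clp : forall i, closed_point (p i)).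
Hypothesis loewy_mu : forall i, loewy_length (local_ring (p i)) (mu i).

(** If all linear forms vanishing at [p l] vanished at [p i], the first ideal,
which they generate, would be contained in the second; both points are closed
and distinct. *)
Lemma separating_linear_form i l : l != i ->
  exists h : S, [/\ h \is 1.-homog, p l h & ~ p i h].
Proof.
move=> li; have [j [a [pj pa]]] := closed_point_coords (@clp l).
have [m pim] : exists m, ~ p i (shifted_var j a m).
  apply: contrapT => /forallNP H.
  have {}H m : p i (shifted_var j a m) by apply: contrapT => /H.
  suff s : ideal_sub (p l) (p i).
    by move/eqP: li; apply; apply: injp; apply/esym/clp.
  move=> f plf; apply: ideal_pihomog => d.
  have [v -> _] := ideal_dhomog_expand pj (@point_prime _ _ _ (p l))
    (@point_proper _ _ _ (p l)) pa (pihomogP mdeg d f) (ideal_homog d plf).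
  by apply: ideal_sum => m _; apply: idealMl.
by exists (shifted_var j a m); split=> //; apply: dhomog_shifted_var.
Qed.

(** For every other point, take the power of a separating linear form that is zero
in the local ring there. *)
Lemma separating_form i : exists G : S,
  [/\ G \is (\sum_(l | l != i) (mu l).+1).-homog, ~ p i G &
      forall l, l != i -> saturation (p l) G].
Proof.
have /choice[h hh] : forall l, exists h : S, l != i ->
    [/\ h \is 1.-homog, p l h & ~ p i h].
  move=> l; have [->|li] := eqVneq l i; first by exists 0.
  by have [h ?] := separating_linear_form li; exists h.
exists (\prod_(l | l != i) h l ^+ (mu l).+1); split.
- apply: (big_rec2 (fun (f : S) d => f \is d.-homog)) => [|l d f li hf].
    exact: dhomog1.
  apply: dhomogM hf; have [h1 _ _] := hh l li.
  by have := dhomogMn (mu l).+1 h1; rewrite mul1n.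
- apply: (big_ind (fun f => ~ p i f)) => [|f g|l li].
  + exact: point_proper.
  + exact: point_notM.
  + move/(prime_exp (@point_proper _ _ _ _) (@point_prime _ _ _ _)).
    by have [] := hh l li.
- move=> l li; rewrite (bigD1 l) //= mulrC; apply: saturationM.
  have -> : h l ^+ (mu l).+1 = \prod_(z <- nseq (mu l).+1 (h l)) z.
    by rewrite big_nseq iter_mulr_1.
  apply: loewy_saturation (loewy_mu l) _ _; first by rewrite size_nseq.
  by move=> z /nseqP[-> _]; have [] := hh l li.
Qed.

(** A form of degree [D] with prescribed germs [f i / g i] at all the points.  It is
a sum over [i] of a form that separates [p i] from the other points, times a
form adjusting the germ at [p i]; the latter has degree at least [mu i] exactly
when [D] is at least the sum of the [mu i + 1], minus [1]. *)
Lemma interpolation D (e : 'I_t -> nat) (f g : 'I_t -> S) :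
    (\sum_i (mu i).+1 <= D.+1)%N ->
    (forall i, [/\ g i \is (e i).-homog, ~ p i (g i) & f i \is (e i + D).-homog]) ->
  exists2 s, s \is D.-homog & forall i, saturation (p i) (f i - g i * s).
Proof.
move=> sumD hfg; have /choice[G hG] := separating_form.
have /choice[h hh] : forall i, exists h,
    G i * h \is D.-homog /\ saturation (p i) (f i - g i * G i * h).
  move=> i; have [hg pg hf] := hfg i; have [hGi pG _] := hG i.
  have [j [a [pj pa]]] := closed_point_coords (@clp i).
  move: sumD; rewrite (bigD1 i) //=.
  set d := (\sum_(l | l != i) (mu l).+1)%N in hGi *; rewrite addSn ltnS => sumD.
  have [||h hhom sh] := local_interpolation pj pa (loewy_mu i) (dhomogM hg hGi)
    (point_notM pg pG) (e := (D - d)%N) (f := f i).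
  - by lia.
  - by have -> : (e i + d + (D - d) = e i + D)%N by lia.
  - exists h; split=> //; have -> : D = (d + (D - d))%N by lia.
    exact: dhomogM.
exists (\sum_l G l * h l).
  by apply: rpred_sum => l _; have [] := hh l.
move=> i; rewrite (bigD1 i) //= mulrDr opprD addrA mulrA; apply: saturationD.
  by have [] := hh i.
rewrite -mulrN -sumrN mulr_sumr.
apply: big_ind => [|f1 f2|l li]; [exact: saturation0|exact: saturationD|].
rewrite -mulrN mulrCA mulrC; apply: saturationM.
by have [_ _] := hG l; apply; rewrite eq_sym.
Qed.
End Interpolation.

(** * Cohomology of the twists of the structure sheaf *)

Section StructureSheaf.
Variables (F : fieldType) (n : nat).
Local Notation S := {mpoly F[n.+1]}.
Local Notation K := {fraction {mpoly F[n.+1]}}.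
Local Notation "f %:F" := (@FracField.tofrac _ f).
Implicit Types (J : {set 'I_n.+1}) (f : S).

(** Its sheaf is the structure sheaf: [ideal_sheaf unit_ideal k J] is the set of
sections of [O(k)] over the open set of [J]. *)
Definition unit_ideal : homog_ideal F n :=
  @HomogIdeal F n (fun=> True) I (fun _ _ _ _ => I) (fun _ _ _ => I) (fun _ _ _ => I).

Lemma cech_diffE (c : {set 'I_n.+1} -> K) J : cech_diff c J = cech_delta c J.
Proof. by []. Qed.

Lemma mpolyX_neq0 m : 'X_[m] != 0 :> S.
Proof. by rewrite -msupp_eq0 msuppX. Qed.

Definition power_mnm N J : 'X_{1..n.+1} := [multinom (N * (i \in J))%N | i < n.+1].

Lemma power_mnmE N J : (\prod_(j in J) 'X_j) ^+ N = 'X_[power_mnm N J] :> S.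
Proof.
rewrite mpolyXE_id big_mkcond /= -prodrXl; apply: eq_bigr => j _.
by rewrite mnmE; case: (j \in J); rewrite ?muln1 // muln0 expr1n.
Qed.

Lemma mdeg_power_mnm N J : mdeg (power_mnm N J) = (N * #|J|)%N.
Proof.
rewrite mdegE -sum1_card big_distrr [RHS]big_mkcond /=; apply: eq_bigr => j _.
by rewrite mnmE; case: (j \in J); rewrite ?muln1 ?muln0.
Qed.

Definition monomial_part (Q : pred 'X_{1..n.+1}) f : S :=
  \sum_(m <- msupp f | Q m) f@_m *: 'X_[m].

Lemma mcoeff_monomial_part Q f m :
  (monomial_part Q f)@_m = if Q m then f@_m else 0.
Proof.
rewrite /monomial_part raddf_sum /= big_mkcond /=.
transitivity (\sum_(m' <- msupp f) if Q m then (f@_m' *: 'X_[m'] : S)@_m else 0).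
  apply: eq_bigr => m' _; rewrite mcoeffZ mcoeffX.
  by case: eqP => [->//|_]; rewrite mulr0; do 2?case: ifP.
by case: ifP => _; [rewrite -raddf_sum /= -mpolyE|rewrite big1].
Qed.

Fact monomial_part_additive Q : zmod_morphism (monomial_part Q).
Proof.
move=> f g; apply/mpolyP => m; rewrite mcoeffB !mcoeff_monomial_part.
by case: ifP; rewrite ?mcoeffB ?subrr.
Qed.

HB.instance Definition _ Q :=
  GRing.isZmodMorphism.Build S S (monomial_part Q) (monomial_part_additive Q).

Section Degree.
Variables (k : int) (N D : nat).
Hypothesis DE : D%:Z = k + (N * n.+1)%N%:Z.
Local Notation XT := ('X_[power_mnm N setT] : S).

(** With the common denominator [XT], the [N]-th power of the product of all the
variables, the Laurent monomial of numerator [m] is a section of [O(k)] over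
the open set of [J] when only the variables of [J] have negative exponents. *)
Definition laurent_section_mnm J (m : 'X_{1..n.+1}) :=
  (mdeg m == D) && [forall i, (i \in J) || (N <= m i)%N].

Definition laurent_section J f := forall m, ~~ laurent_section_mnm J m -> f@_m = 0.

Lemma laurent_section_sum (T : Type) (r : seq T) (Q : pred T) (f : T -> S) J :
  (forall i, Q i -> laurent_section J (f i)) ->
  laurent_section J (\sum_(i <- r | Q i) f i).
Proof.
by move=> h m Jm; rewrite raddf_sum big1 //= => i Qi; apply: h.
Qed.

Lemma laurent_section_mulsign J f e :
  laurent_section J f -> laurent_section J ((-1) ^+ e * f).
Proof.
move=> h m Jm; rewrite -signr_odd mulr_sign.
by case: ifP => _; rewrite ?mcoeffN h ?oppr0.
Qed.

Lemma laurent_section_frac J f :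
  0 <= k + N%:Z -> (0 < #|J|)%N -> laurent_section J f ->
  ideal_sheaf unit_ideal k J (f%:F / XT%:F).
Proof.
move=> kN J0 hf; pose m0 := power_mnm N (~: J).
pose g := \sum_(m <- msupp f) f@_m *: 'X_[m - m0] : S.
have good m : m \in msupp f -> laurent_section_mnm J m.
  by apply: contraLR => /hf fm; rewrite mcoeff_msupp fm eqxx.
have le m : m \in msupp f -> (m0 <= m)%MM.
  move=> /good /andP[_ /forallP h]; apply/mnm_lepP => i.
  by rewrite mnmE inE; case: (i \in J) (h i) => /=; rewrite ?muln0 ?muln1.
have fE : f = g * 'X_[m0].
  rewrite mulr_suml [LHS]mpolyE big_seq [RHS]big_seq; apply: eq_bigr => m ms.
  by rewrite -scalerAl -mpolyXD submK // le.
have T0 : 'X_[power_mnm N setT] = 'X_[power_mnm N J] * 'X_[m0] :> S.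
  rewrite -mpolyXD; congr 'X_[_]; apply/mnmP => i; rewrite mnmDE !mnmE !inE.
  by case: (i \in J); rewrite ?muln0 ?muln1 ?addn0.
exists N, (D - N * #|~: J|)%N, g; split=> //.
- rewrite /g big_seq; apply: rpred_sum => m ms.
  rewrite rpredZ // dhomogX /= -(mdeg_power_mnm N (~: J)) -/m0.
  have /andP[/eqP <- _] := good _ ms.
  by rewrite -{2}(submK (le _ ms)) mdegD addnK.
- have cJ : (#|J| + #|~: J| = n.+1)%N by rewrite cardsC card_ord.
  by nia.
by rewrite power_mnmE fE T0 !rmorphM /= -mulf_div divff ?mulr1 // tofrac_eq0 mpolyX_neq0.
Qed.

Lemma laurent_section_of_frac J M d f : (M <= N)%N -> f \is d.-homog ->
    d%:Z = k + (M * #|J|)%N%:Z ->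
  exists2 g, laurent_section J g &
    f%:F / ((\prod_(j in J) 'X_j) ^+ M)%:F = g%:F / XT%:F.
Proof.
move=> MN hf dE; pose m0 := (power_mnm (N - M) J + power_mnm N (~: J))%MM.
exists (f * 'X_[m0]).
  move=> m; apply: contraNeq; rewrite -mcoeff_msupp.
  move/perm_mem : (msuppMX f m0) => -> /mapP[m' ms ->].
  have /= em' := dhomog_mf hf ms.
  have cJ : (#|J| + #|~: J| = n.+1)%N by rewrite cardsC card_ord.
  apply/andP; split.
    by rewrite !mdegD em' !mdeg_power_mnm; apply/eqP; nia.
  apply/forallP => i; rewrite !mnmDE !mnmE inE.
  by case: (i \in J) => //=; rewrite muln1 muln0; lia.
have -> : 'X_[power_mnm N setT] = (\prod_(j in J) 'X_j) ^+ M * 'X_[m0] :> S.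
  rewrite power_mnmE -mpolyXD; congr 'X_[_]; apply/mnmP => i.
  by rewrite !mnmDE !mnmE !inE; case: (i \in J); lia.
by rewrite !rmorphM /= -mulf_div divff ?mulr1 // tofrac_eq0 mpolyX_neq0.
Qed.

Definition first_large (m : 'X_{1..n.+1}) := [pick i | (N <= m i)%N].

(** Each monomial of a numerator is attributed to one variable [j] whose exponent
in the quotient by [XT] is nonnegative; such a Laurent monomial extends across
['X_j = 0]. *)
Definition large_part j := monomial_part (fun m => first_large m == Some j).

Lemma laurent_section_large_part J f j : j \notin J ->
  laurent_section (j |: J) f -> laurent_section J (large_part j f).
Proof.
move=> jJ hf m Jm; rewrite mcoeff_monomial_part; case: eqP => // e.
apply: hf; apply: contra Jm => /andP[md /forallP h]; apply/andP; split=> //.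
apply/forallP => i; have := h i; rewrite !inE.
case: eqVneq => //= -> _; move: e; rewrite /first_large.
by case: pickP => // x h' [<-]; rewrite h' orbT.
Qed.

(** A Laurent monomial with all exponents negative has degree at most [- n - 1],
so none occurs in degree [k >= - n]. *)
Lemma laurent_section_partition J f : - n%:Z <= k ->
  laurent_section J f -> \sum_j large_part j f = f.
Proof.
move=> kn hf; apply/mpolyP => m; rewrite raddf_sum /=.
under eq_bigr do rewrite mcoeff_monomial_part.
have [mJ|mJ] := boolP (laurent_section_mnm J m); last first.
  by rewrite (hf _ mJ) big1 // => j _; case: ifP.
rewrite -big_mkcond /= /first_large; case: pickP => [i hi|noi].
  by rewrite (big_pred1 i) // => j; rewrite eq_sym; apply/eqP/eqP => [[]|->].
exfalso; have /andP[/eqP md _] := mJ.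
have : (mdeg m <= N.-1 * n.+1)%N.
  rewrite mdegE -[X in (_ * X)%N]card_ord mulnC -sum_nat_const; apply: leq_sum => i _.
  by have := noi i; lia.
by have := noi ord0; rewrite md; nia.
Qed.
End Degree.

Lemma tofrac_cech_diff (B : {set 'I_n.+1} -> S) (u : S) J :
  cech_diff (fun J => (B J)%:F / u%:F) J = (cech_delta B J)%:F / u%:F.
Proof.
rewrite /cech_diff /cech_delta rmorph_sum mulr_suml; apply: eq_bigr => l _.
by rewrite /cech_sign rmorphM rmorph_sign mulrA.
Qed.

(** Split a cocycle into its parts [large_part j].  These remain cocycles, and the
[j]-th one consists of monomials extending across ['X_j = 0], so that the cone
with vertex [j] contracts it. *)
Lemma structure_sheaf_vanishing (k : int) q : - n%:Z <= k ->
  cohomology_vanishes (ideal_sheaf unit_ideal k) q.+1.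
Proof.
move=> kn c [hc cyc].
have /choice[M hM] : forall J, exists M : nat, #|J| = q.+2 -> exists d f,
    [/\ f \is d.-homog, d%:Z = k + (M * #|J|)%N%:Z
      & c J = f%:F / ((\prod_(j in J) 'X_j) ^+ M)%:F].
  move=> J; have [/eqP/hc[M [d [f [hf _ dE e]]]]|nJ] := boolP (#|J| == q.+2).
    by exists M => _; exists d, f.
  by exists 0%N => /eqP; rewrite (negPf nJ).
(* [N] bounds all the exponents of the denominators, and is large enough for
   [k + N] to be nonnegative. *)
pose N := (\sum_J M J + `|k|.+1)%N.
have MN J : (M J <= N)%N by rewrite /N (bigD1 J) //= -!addnA leq_addr.
have kN : 0 <= k + N%:Z by rewrite /N; lia.
pose D := absz (k + (N * n.+1)%N%:Z).
have DE : D%:Z = k + (N * n.+1)%N%:Z by rewrite gez0_abs //; nia.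
pose XT : S := 'X_[power_mnm N setT].
have XT0 : XT%:F != 0 by rewrite tofrac_eq0 mpolyX_neq0.
have /choice[f hf] : forall J, exists f : S, #|J| = q.+2 ->
    laurent_section N D J f /\ c J = f%:F / XT%:F.
  move=> J; have [/eqP eJ|nJ] := boolP (#|J| == q.+2); last first.
    by exists 0 => /eqP; rewrite (negPf nJ).
  have [d [f [hf dE ->]]] := hM J eJ.
  by have [g hg ->] := laurent_section_of_frac DE (MN J) hf dE; exists g.
have df J : #|J| = q.+3 -> cech_delta f J = 0.
  move=> eJ; have := cyc J eJ.
  have -> : cech_diff c J = cech_diff (fun J => (f J)%:F / XT%:F) J.
    apply: eq_bigr => l lJ; congr (_ * _); apply: (hf _ _).2.
    by apply/eqP; rewrite -eqSS -eJ (cardsD1 l J) lJ.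
  rewrite tofrac_cech_diff => /eqP; rewrite mulf_eq0 invr_eq0 (negPf XT0) orbF.
  by rewrite tofrac_eq0 => /eqP.
pose B J := \sum_j cech_cone j (fun J => large_part N j (f J)) J.
exists (fun J => (B J)%:F / XT%:F).
  move=> J eJ; apply: (laurent_section_frac DE kN); first by rewrite eJ.
  apply: laurent_section_sum => j _; rewrite /cech_cone.
  case: ifPn => jJ; first by move=> m _; rewrite mcoeff0.
  apply: laurent_section_mulsign; apply: laurent_section_large_part => //.
  by apply: (hf _ _).1; rewrite cardsU1 jJ eJ.
move=> J eJ; rewrite tofrac_cech_diff (hf J eJ).2; congr (_%:F / _).
rewrite -[LHS](laurent_section_partition DE kn (hf J eJ).1) {1}/B.
have -> : cech_delta B J =
    \sum_j cech_delta (cech_cone j (fun J => large_part N j (f J))) J.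
  by rewrite /cech_delta /B; under eq_bigr do rewrite mulr_sumr; rewrite exchange_big.
apply: eq_bigr => j _.
rewrite -[LHS](cech_cone_homotopy j (fun J => large_part N j (f J))).
rewrite [X in _ + X](_ : _ = 0) ?addr0 //.
rewrite /cech_cone; case: ifPn => // jJ.
suff -> : cech_delta (fun J => large_part N j (f J)) (j |: J) = large_part N j 0.
  by rewrite /large_part raddf0 mulr0.
rewrite -(df (j |: J)); last by rewrite cardsU1 jJ eJ.
rewrite /cech_delta /large_part raddf_sum; apply: eq_bigr => l _.
by rewrite /cech_sign -signr_odd !mulr_sign; case: ifP; rewrite ?raddfN.
Qed.
End StructureSheaf.

(** * Sections of the ideal sheaf *)

Section IdealSheaf.
Variables (F : fieldType) (n : nat).
Local Notation S := {mpoly F[n.+1]}.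
Local Notation K := {fraction {mpoly F[n.+1]}}.
Local Notation "f %:F" := (@FracField.tofrac _ f).
Local Notation "''X_{in' J }" := (\prod_(j in J) 'X_j : S)
  (at level 8, format "''X_{in'  J }").
Implicit Types (J : {set 'I_n.+1}) (X : closed_subscheme F n) (k : int).

Lemma prod_var_frac_neq0 J N : ('X_{in J} ^+ N)%:F != 0 :> K.
Proof. by rewrite power_mnmE tofrac_eq0 mpolyX_neq0. Qed.

Lemma dhomog_prod_varX J N : 'X_{in J} ^+ N \is (N * #|J|).-homog.
Proof. by rewrite power_mnmE dhomogX /= mdeg_power_mnm. Qed.

Lemma point_prod_var X (p : point X) J :
  ~ p 'X_{in J} <-> forall j, j \in J -> ~ p 'X_j.
Proof.
split=> [pJ j jJ pj|h].
  by apply: pJ; rewrite (bigD1 j) //=; apply: idealMl.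
apply: (big_ind (fun f => ~ p f)) => //; first exact: point_proper.
exact: point_notM.
Qed.

Lemma point_prod_varX X (p : point X) J N : ~ p 'X_{in J} -> ~ p ('X_{in J} ^+ N).
Proof. by move=> pJ /(prime_exp (@point_proper _ _ _ _) (@point_prime _ _ _ _)). Qed.

Lemma ideal_sheaf0 X k J : (0 < #|J|)%N -> ideal_sheaf X k J 0.
Proof.
move=> J0; exists (absz k), (absz (k + (absz k * #|J|)%N%:Z)), 0.
split; [exact: rpred0|exact: ideal0| |by rewrite rmorph0 mul0r].
by rewrite gez0_abs //; nia.
Qed.

Lemma ideal_sheafD X k J x y :
  ideal_sheaf X k J x -> ideal_sheaf X k J y -> ideal_sheaf X k J (x + y).
Proof.
move=> [N [d [f [hf Xf dE ->]]]] [M [e [g [hg Xg eE ->]]]].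
have hfM := dhomogM hf (dhomog_prod_varX J M).
have hgN := dhomogM hg (dhomog_prod_varX J N).
have E : (e + N * #|J| = d + M * #|J|)%N by lia.
exists (N + M)%N, (d + M * #|J|)%N, (f * 'X_{in J} ^+ M + g * 'X_{in J} ^+ N); split.
- by rewrite rpredD // -E.
- by apply: idealD; apply: idealMl.
- by lia.
- by rewrite addf_div ?prod_var_frac_neq0 // exprD !rmorphD !rmorphM.
Qed.

Lemma ideal_sheaf_sign X k J e x :
  ideal_sheaf X k J x -> ideal_sheaf X k J ((-1) ^+ e * x).
Proof.
move=> [N [d [f [hf Xf dE ->]]]]; exists N, d, ((-1) ^+ e * f); split=> //.
- by rewrite -signr_odd mulr_sign; case: ifP; rewrite ?rpredN.
- exact: idealM.
- by rewrite rmorphM rmorph_sign mulrA.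
Qed.

Lemma ideal_sheaf_sub X Y k J x : ideal_sub X Y ->
  ideal_sheaf X k J x -> ideal_sheaf Y k J x.
Proof.
by move=> XY [N [d [f [hf Xf dE ->]]]]; exists N, d, f; split=> //; apply: XY.
Qed.

Lemma ideal_sheaf_restrict X k J J' x : J \subset J' ->
  ideal_sheaf X k J x -> ideal_sheaf X k J' x.
Proof.
move=> JJ' [N [d [f [hf Xf dE ->]]]].
have cJ : (#|J| + #|J' :\: J| = #|J'|)%N.
  by rewrite -(cardsID J J') (setIidPr JJ').
have eJ : 'X_{in J'} = 'X_{in J} * 'X_{in J' :\: J}.
  by rewrite (big_setID J) (setIidPr JJ').
exists N, (d + N * #|J' :\: J|)%N, (f * 'X_{in J' :\: J} ^+ N); split.
- exact: dhomogM hf (dhomog_prod_varX _ _).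
- exact: idealMl.
- by rewrite -cJ; nia.
- rewrite eJ exprMn !rmorphM -mulf_div divff ?mulr1 //.
  exact: prod_var_frac_neq0.
Qed.

Section VanishingGerms.
Variables (X : closed_subscheme F n) (p : point X).

(** The elements of [K] that lie in the ideal generated by [X] in the localization
of [S] at [p]; a section of [O(k)] near [p] is such exactly when its germ is in
the stalk of the ideal sheaf. *)
Definition vanishing_germ (x : K) := exists f g, [/\ X f, ~ p g & x = f%:F / g%:F].

Lemma vanishing_germ0 : vanishing_germ 0.
Proof.
by exists 0, 1; split; [exact: ideal0|exact: point_proper|rewrite rmorph0 mul0r].
Qed.

Lemma vanishing_germD x y :
  vanishing_germ x -> vanishing_germ y -> vanishing_germ (x + y).
Proof.
move=> [f [g [Xf pg ->]]] [f' [g' [Xf' pg' ->]]].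
exists (f * g' + f' * g), (g * g'); split; last first.
- by rewrite addf_div ?(point_frac_neq0 (p := p)) // rmorphD !rmorphM.
- exact: point_notM.
- by apply: idealD; apply: idealMl.
Qed.

Lemma vanishing_germ_sign e x : vanishing_germ x -> vanishing_germ ((-1) ^+ e * x).
Proof.
move=> [f [g [Xf pg ->]]]; exists ((-1) ^+ e * f), g; split=> //; first exact: idealM.
by rewrite rmorphM rmorph_sign mulrA.
Qed.

Lemma vanishing_germ_saturation f g : saturation p f -> ~ p g ->
  vanishing_germ (f%:F / g%:F).
Proof.
move=> [u pu Xf] pg; exists (u * f), (u * g); split=> //; first exact: point_notM.
by rewrite !rmorphM -mulf_div divff ?mul1r // (point_frac_neq0 (p := p)).
Qed.

Lemma vanishing_germ_ideal_sheaf k J x : ~ p 'X_{in J} ->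
  ideal_sheaf X k J x -> vanishing_germ x.
Proof.
move=> pJ [N [d [f [_ Xf _ ->]]]]; exists f, ('X_{in J} ^+ N); split=> //.
exact: point_prod_varX.
Qed.
End VanishingGerms.

(** Let [f] be the numerator of [x].  The colon ideal [(X : f)] is contained in no
point at which the variables of [J] do not vanish, so it contains a power of
the product of these variables by [prime_avoiding]. *)
Lemma ideal_sheaf_of_germs X k J x : (0 < #|J|)%N ->
    ideal_sheaf (unit_ideal F n) k J x ->
    (forall p : point X, ~ p 'X_{in J} -> vanishing_germ p x) ->
  ideal_sheaf X k J x.
Proof.
move=> J0 [N [d [f [hf _ dE ->]]]] germs.
have hJ : 'X_{in J} \is (#|J|).-homog.
  by have := dhomog_prod_varX J 1; rewrite expr1 mul1n.
have [M XM] : exists M, X ('X_{in J} ^+ M * f).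
  apply: contrapT => /forallNP noM.
  have [Q [sQ QJ Q1 prQ]] := @prime_avoiding _ _ (ideal_colon X hf) _ _ hJ noM.
  have XQ : ideal_sub X Q by move=> g Xg; apply: sQ; apply: idealMl.
  have [j jJ] := card_gt0P J0.
  have Qj : ~ Q 'X_j.
    by move=> Qj; apply: QJ; rewrite (bigD1 j) //=; apply: idealMl.
  pose p := Point Q1 prQ (ex_intro _ j Qj) XQ.
  have [a [g [Xa pg]]] := germs p QJ.
  move/(@frac_eq _ _ _ p _ _ _ _ (@point_prod_varX _ p _ N QJ) pg) => E.
  apply: pg; apply: (sQ g); rewrite /= /ideal_colon_pred mulrC E.
  exact: idealMl.
exists (N + M)%N, (d + M * #|J|)%N, ('X_{in J} ^+ M * f); split=> //.
- by rewrite addnC; apply: dhomogM hf; apply: dhomog_prod_varX.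
- by lia.
- by rewrite addnC exprD !rmorphM -mulf_div divff ?mul1r // prod_var_frac_neq0.
Qed.

Lemma cohomology_above_dimension X k q : (n < q)%N ->
  cohomology_vanishes (ideal_sheaf X k) q.
Proof.
case: q => // q nq c _; exists (fun=> 0).
  by move=> J eJ; apply: ideal_sheaf0; rewrite eJ.
move=> J eJ; have := max_card (mem J); rewrite card_ord eJ ltnS.
by rewrite leqNgt nq.
Qed.
End IdealSheaf.

(** * Vanishing of the cohomology of the ideal sheaf *)

Section Vanishing.
Variables (F : closedFieldType) (n t : nat) (X : closed_subscheme F n).
Local Notation S := {mpoly F[n.+1]}.
Local Notation K := {fraction {mpoly F[n.+1]}}.
Local Notation "f %:F" := (@FracField.tofrac _ f).
Local Notation "''X_{in' J }" := (\prod_(j in J) 'X_j : S)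
  (at level 8, format "''X_{in'  J }").
Implicit Types (J : {set 'I_n.+1}).
Variables (p : 'I_t -> point X) (mu : 'I_t -> nat).
Hypotheses (injp : injective p) (clp : forall i, closed_point (p i)).
Hypothesis all_points : forall q : point X, exists i, q = p i.
Hypothesis loewy_mu : forall i, loewy_length (local_ring (p i)) (mu i).

(** [interpolation] for sections over the open set of [J]: after clearing the
denominator, it asks for a form of degree [D = k + N * #|J|]. *)
Lemma germ_interpolation (k : int) (N D : nat) J (y : 'I_t -> K) :
    D%:Z = k + (N * #|J|)%N%:Z -> (\sum_i (mu i).+1 <= D.+1)%N ->
    (forall i, ~ p i 'X_{in J} -> exists2 J' : {set 'I_n.+1}, ~ p i 'X_{in J'} &
       ideal_sheaf (unit_ideal F n) k J' (y i) \/ y i = 0) ->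
  exists2 s, s \is D.-homog & forall i, ~ p i 'X_{in J} ->
    vanishing_germ (p i) (y i - s%:F / ('X_{in J} ^+ N)%:F).
Proof.
move=> DE sumD hy.
have /choice[w hw] : forall i, exists w : nat * (S * S),
    [/\ w.2.2 \is w.1.-homog, ~ p i w.2.2, w.2.1 \is (w.1 + D).-homog &
        ~ p i 'X_{in J} -> y i * ('X_{in J} ^+ N)%:F = w.2.1%:F / w.2.2%:F].
  move=> i; have [pJ|npJ] := pselect (p i 'X_{in J}).
    by exists (0%N, (0, 1)); split=> //=;
      [exact: dhomog1|exact: point_proper|exact: rpred0].
  have [J' pJ' [[M [d [f [hf _ dE e]]]]|->]] := hy i npJ; last first.
    exists (0%N, (0, 1)); split=> /=;
      [exact: dhomog1|exact: point_proper|exact: rpred0|].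
    by rewrite rmorph0 !mul0r.
  exists ((M * #|J'|)%N, (f * 'X_{in J} ^+ N, 'X_{in J'} ^+ M)); split=> /=.
  - exact: dhomog_prod_varX.
  - exact: point_prod_varX.
  - have -> : (M * #|J'| + D = d + N * #|J|)%N by lia.
    exact: dhomogM hf (dhomog_prod_varX _ _ _).
  - by move=> _; rewrite e rmorphM mulrAC.
have [|s hs ss] := @interpolation _ _ _ _ _ _ injp clp loewy_mu D
    (fun i => (w i).1) (fun i => (w i).2.1) (fun i => (w i).2.2) sumD.
  by move=> i; have [] := hw i.
exists s => // i pJ; have [_ pg _ /(_ pJ) e] := hw i.
have J0 := prod_var_frac_neq0 F J N.
have -> : y i - s%:F / ('X_{in J} ^+ N)%:F =
    ((w i).2.1 - (w i).2.2 * s)%:F / ((w i).2.2 * 'X_{in J} ^+ N)%:F.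
  have g0 := point_frac_neq0 pg.
  rewrite -[y i](mulfK J0) e -mulrBl rmorphB !rmorphM invfM mulrA.
  by congr (_ / _); rewrite mulrBl [_ * s%:F]mulrC mulfK.
apply: vanishing_germ_saturation => //.
by apply: point_notM => //; apply: point_prod_varX.
Qed.

(** The condition on [k] is only imposed on [H^1]: for [q > 0] the interpolating
sections live over proper open sets and may have denominators of high order. *)
Lemma ideal_sheaf_vanishing (k : int) q : (0 < t)%N -> - n%:Z <= k ->
    (q = 0%N -> (\sum_i (mu i).+1)%N%:Z - 1 <= k) ->
  cohomology_vanishes (ideal_sheaf X k) q.+1.
Proof.
move=> t0 kn kq c [hc cyc].
have subU : ideal_sub X (unit_ideal F n) by [].
(* [b] represents a cocycle with values in [O_X(k)]; the sections [b'] defined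
   below make it a coboundary modulo the ideal sheaf. *)
have [b hb cb] : cech_coboundary (ideal_sheaf (unit_ideal F n) k) q.+1 c.
  apply: structure_sheaf_vanishing => //; split=> // J /hc.
  exact: ideal_sheaf_sub.
have /choice[jj pjj] : forall i, exists j, ~ p i 'X_j.
  by move=> i; apply: point_relevant.
(* For [q = 0] the degree [D] is [k] itself, and for [q > 0] it is as large
   as wanted.  The sum is positive, so that [k] is nonnegative if [q = 0]. *)
pose sum_mu := (\sum_i (mu i).+1)%N; pose N := (sum_mu + absz k)%N.
have sum_mu0 : (0 < sum_mu)%N by rewrite /sum_mu (bigD1 (Ordinal t0)).
pose D := absz (k + (N * q)%N%:Z).
have DE : D%:Z = k + (N * q)%N%:Z.
  rewrite gez0_abs //; case: (q) kq => [/(_ erefl)|q' _]; first by lia.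
  by rewrite /N; nia.
have sumD : (sum_mu <= D.+1)%N.
  by case: (q) kq DE => [/(_ erefl)|q' _]; rewrite /N; nia.
(* The germ at [p i] of the section over [J] is that of the cone with vertex
   [jj i] over [b]: near [p i], the open set of [jj i] is the whole space. *)
have /choice[s hs] : forall J, exists s : S, #|J| = q -> s \is D.-homog /\
    forall i, ~ p i 'X_{in J} ->
      vanishing_germ (p i) (cech_cone (jj i) b J - s%:F / ('X_{in J} ^+ N)%:F).
  move=> J; have [/eqP eJ|/eqP nJ] := boolP (#|J| == q); last by exists 0.
  have [|||s hs ss] := @germ_interpolation k N D J (fun i => cech_cone (jj i) b J).
  - by rewrite eJ.
  - exact: sumD.
  - move=> i pJ; exists (jj i |: J).
      apply/point_prod_var => j; rewrite !inE => /orP[/eqP->//|jJ].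
      by move/point_prod_var: pJ; apply.
    rewrite /cech_cone; case: ifPn => jJ; [by right|left].
    by apply/ideal_sheaf_sign/hb; rewrite cardsU1 jJ eJ.
  - by exists s.
pose b' J := (s J)%:F / ('X_{in J} ^+ N)%:F.
exists (fun J => b J - cech_diff b' J); last first.
  move=> J eJ; rewrite cech_diffE cech_deltaB -cech_diffE -cb // cech_delta_delta.
  by rewrite subr0.
move=> J eJ; apply: ideal_sheaf_of_germs; first by rewrite eJ.
  apply: ideal_sheafD; first exact: hb.
  rewrite -mulN1r -[-1]expr1; apply: ideal_sheaf_sign.
  apply: big_ind => [|x y|l lJ].
  - by apply: ideal_sheaf0; rewrite eJ.
  - exact: ideal_sheafD.
  have eJl : #|J :\ l| = q by apply/eqP; rewrite -eqSS -eJ (cardsD1 l J) lJ.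
  apply: ideal_sheaf_sign; apply: ideal_sheaf_restrict (subD1set J l) _.
  by exists N, D, (s (J :\ l)); split=> //; [exact: (hs _ eJl).1|rewrite eJl].
move=> P; have [i ->] := all_points P => pJ.
(* With [h] the cone at [jj i], [b - d b' = d (h b - b') + h (d b)] where
   [d b = c] has values in the ideal sheaf. *)
rewrite cech_diffE -(cech_cone_homotopy (jj i) b J) addrAC -cech_deltaB.
apply: vanishing_germD.
  apply: big_ind => [|x y|l lJ]; [exact: vanishing_germ0|exact: vanishing_germD|].
  have eJl : #|J :\ l| = q by apply/eqP; rewrite -eqSS -eJ (cardsD1 l J) lJ.
  apply: vanishing_germ_sign; apply: (hs _ eJl).2.
  apply/point_prod_var => j; rewrite !inE => /andP[_ jJ].
  by move/point_prod_var: pJ; apply.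
rewrite /cech_cone; case: ifPn => jJ; first exact: vanishing_germ0.
have eJ' : #|jj i |: J| = q.+2 by rewrite cardsU1 jJ eJ.
rewrite -cech_diffE -cb //; apply: vanishing_germ_sign.
apply: vanishing_germ_ideal_sheaf (hc _ eJ').
apply/point_prod_var => j; rewrite !inE => /orP[/eqP->//|jJ'].
by move/point_prod_var: pJ; apply.
Qed.
End Vanishing.

Theorem theorem2p2 (R : realType) (n t : nat) (X : closed_subscheme R[i] n)
    (p : 'I_t -> point X) (mu : 'I_t -> nat) :
  dimension X 0 ->
  injective p ->
  (forall i, closed_point (p i)) ->
  (forall q : point X, exists i, q = p i) ->
  (forall i, loewy_length (local_ring (p i)) (mu i)) ->
  (forall k : int, (\sum_(i < t) mu i + t)%N%:Z - 1 <= k ->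
     cohomology_vanishes (ideal_sheaf X k) 1) /\
  regular X (\sum_(i < t) mu i + t)%N%:Z.
Proof.
move=> [[P _] _] injp clp all_points loewy_mu.
have t0 : (0 < t)%N.
  by have [i _] := all_points (P ord0); apply: leq_ltn_trans (ltn_ord i).
have sumE : (\sum_(i < t) mu i + t = \sum_(i < t) (mu i).+1)%N.
  rewrite -[X in (_ + X)%N]card_ord -sum1_card -big_split.
  by apply: eq_bigr => i _; rewrite /= addn1.
have van (k : int) q : (\sum_(i < t) mu i + t)%N%:Z - q.+1%:Z <= k ->
    cohomology_vanishes (ideal_sheaf X k) q.+1.
  move=> hk; have [nq|qn] := ltnP n q.+1; first exact: cohomology_above_dimension.
  apply: (ideal_sheaf_vanishing injp clp all_points loewy_mu t0).
    by lia.
  by move=> q0; rewrite -sumE; move: hk; rewrite q0.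
split=> [k hk|[//|q] _]; first exact: van.
exact: van.
Qed.
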